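(* Let $\mathbb{K}$ be an algebraically closed field of characteristic zero, $f_1,\ldots,f_m\in\mathbb{K}[x_1,\ldots,x_m]$ generating an ideal $I$ with $\mathbb{K}[\mathbf{x}]/I$ finite dimensional (finitely many affine common roots), and let $J=\det(\partial f_i/\partial x_j)_{i,j=1}^m$ be the Jacobian. With the notation below, set $$\ker(\mathfrak{B}_J^{\mathbf{x}}):=\Big\{\lambda=(\lambda_\beta)_{\beta\in E'}\in\mathbb{K}^{E'}:\ \sum_{\alpha\in E,\beta\in E'}c_{\alpha,\beta}(J)\,\mathbf{x}^\alpha\lambda_\beta=0\Big\}.$$ Then $$\sqrt{I}=\Big\{\sum_{\alpha\in E,\beta\in E'}c_{\alpha,\beta}(1)\,\mathbf{x}^\alpha\lambda_\beta:\ \lambda\in\ker(\mathfrak{B}_J^{\mathbf{x}})\Big\}+I.$$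
   Context: Let $\mathbf{x}=(x_1,\ldots,x_m)$, $\mathbf{y}=(y_1,\ldots,y_m)$ and $X_0=(x_1,\ldots,x_m)$, $X_1=(y_1,x_2,\ldots,x_m)$, …, $X_m=(y_1,\ldots,y_m)$ (in $X_i$ the first $i$ coordinates are $y$'s). For $f_0\in\mathbb{K}[\mathbf{x}]$, the Bezoutian of $(f_0,f_1,\ldots,f_m)$ is the polynomial $\mathfrak{B}_{f_0}(\mathbf{x},\mathbf{y})\in\mathbb{K}[\mathbf{x},\mathbf{y}]$ given by the $(m+1)\times(m+1)$ determinant whose row $i$ ($i=0,\ldots,m$) is $\big(f_i(X_0),\ \frac{f_i(X_0)-f_i(X_1)}{x_1-y_1},\ \ldots,\ \frac{f_i(X_{m-1})-f_i(X_m)}{x_m-y_m}\big)$. Write $\mathfrak{B}_{f_0}(\mathbf{x},\mathbf{y})=\sum_{\alpha\in E,\beta\in E'}c_{\alpha,\beta}(f_0)\mathbf{x}^\alpha\mathbf{y}^\beta$ with $c_{\alpha,\beta}(f_0)\in\mathbb{K}$, where $E,E'\subset\mathbb{N}^m$ are finite sets of exponents containing the supports of all Bezoutians considered (here $f_0=1$ and $f_0=J$), coefficients outside the support being $0$. *)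

(* Defs.v *)
From HB Require Import structures.
From mathcomp Require Import all_boot all_order all_algebra.
From mathcomp Require Import mpoly.
From Stdlib Require Import ClassicalEpsilon.
Set Implicit Arguments. Unset Strict Implicit. Unset Printing Implicit Defensive.
Import Order.TTheory GRing.Theory Num.Theory.
Local Open Scope ring_scope.

Section Bez.
Variables (K : fieldType) (m : nat).

(* K[x] = {mpoly K[m]};  K[x,y] = {mpoly K[m + m]}, where variable
   lshift m j is x_(j+1) and rshift m j is y_(j+1). *)
Definition xvar (j : 'I_m) : {mpoly K[m + m]} := 'X_(lshift m j).
Definition yvar (j : 'I_m) : {mpoly K[m + m]} := 'X_(rshift m j).

Definition Xpt (i : nat) : m.-tuple {mpoly K[m + m]} :=
  [tuple if (j < i)%N then yvar j else xvar j | j < m].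

Definition evalX (i : nat) (f : {mpoly K[m]}) : {mpoly K[m + m]} :=
  f \mPo Xpt i.

(* exact quotient p / d in K[x,y] (the unique q with q * d = p when it
   exists; chosen by Hilbert's epsilon). *)
Definition exdiv (p d : {mpoly K[m + m]}) : {mpoly K[m + m]} :=
  epsilon (inhabits 0) (fun q => q * d = p).

Definition fam (f0 : {mpoly K[m]}) (f : 'I_m -> {mpoly K[m]}) (i : 'I_m.+1)
  : {mpoly K[m]} :=
  match unlift ord0 i with None => f0 | Some j => f j end.

Definition bezout_mx (f0 : {mpoly K[m]}) (f : 'I_m -> {mpoly K[m]})
  : 'M[{mpoly K[m + m]}]_m.+1 :=
  \matrix_(i < m.+1, k < m.+1)
    match unlift ord0 k with
    | None => evalX 0 (fam f0 f i)
    | Some j => exdiv (evalX j (fam f0 f i) - evalX j.+1 (fam f0 f i))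
                      (xvar j - yvar j)
    end.

Definition bezoutian (f0 : {mpoly K[m]}) (f : 'I_m -> {mpoly K[m]})
  : {mpoly K[m + m]} := \det (bezout_mx f0 f).

Definition mcat (a b : 'X_{1..m}) : 'X_{1..m + m} :=
  [multinom (match split i with inl j => a j | inr j => b j end) | i < m + m].

Definition bcoef (f0 : {mpoly K[m]}) (f : 'I_m -> {mpoly K[m]})
  (a b : 'X_{1..m}) : K := (bezoutian f0 f)@_(mcat a b).

Definition jacobian (f : 'I_m -> {mpoly K[m]}) : {mpoly K[m]} :=
  \det (\matrix_(i < m, j < m) (f i)^`M(j)).

Definition in_ideal (f : 'I_m -> {mpoly K[m]}) (p : {mpoly K[m]}) : Prop :=
  exists g : 'I_m -> {mpoly K[m]}, p = \sum_(i < m) g i * f i.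

Definition in_radical (f : 'I_m -> {mpoly K[m]}) (p : {mpoly K[m]}) : Prop :=
  exists k : nat, in_ideal f (p ^+ k).

Definition quotient_findim (f : 'I_m -> {mpoly K[m]}) : Prop :=
  exists s : seq {mpoly K[m]}, forall p : {mpoly K[m]},
    exists c : nat -> K, in_ideal f (p - \sum_(i < size s) c i *: s`_i).

Definition bez_apply (f0 : {mpoly K[m]}) (f : 'I_m -> {mpoly K[m]})
  (E E' : seq 'X_{1..m}) (lam : 'X_{1..m} -> K) : {mpoly K[m]} :=
  \sum_(a <- E) \sum_(b <- E') (bcoef f0 f a b * lam b) *: 'X_[a].

End Bez.

(* Main.v *)
Require Import Defs.
From HB Require Import structures.
From mathcomp Require Import all_boot all_order all_algebra.
From mathcomp Require Import mpoly ring.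
From Stdlib Require Import Classical ClassicalEpsilon.
Import GRing.Theory.
Local Open Scope ring_scope.
Set Implicit Arguments. Unset Strict Implicit. Unset Printing Implicit Defensive.

(** Let A = K[x]/I and let D(x,y) be the Bezoutian of (1, f_1, ..., f_m). Modulo
    I(x) the Bezoutian of f_0 is f_0(x) D, modulo I(y) it is f_0(y) D, and
    D(x,x) = J. The point is that D is nondegenerate: there is a linear form tau
    on A with (1 (x) p tau)(D) = p in A for every p.

    To build tau, choose monic univariate P_i with P_i(x_i) in I (characteristic
    polynomials of multiplication by x_i on A) and write (P_i(x_i))_i = M f. For
    the separated system P such a form tau_P is explicit, and D_P = det M(y) D
    modulo I(x) + (P(y)): the matrices of divided differences of both sides have
    the same product with x - y, and by Koszul syzygies of the regular sequence
    x - y their determinants agree. Then tau = tau_P(det M .) works.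

    Writing D = sum u_i (x) b_i, multiplication by q on A is
    p |-> sum_i tau(p b_i) q u_i, so its trace is tau(J q). In characteristic 0,
    p is nilpotent in A iff all the traces of p q vanish; hence J p in I implies
    p in rad(I), and p in rad(I) implies tau(J p q) = 0 for all q. The first gives
    one inclusion; for the other one takes lambda = p tau. *)

(** * Ideals and determinants modulo Koszul syzygies *)

Section Ideals.
Variable R : comNzRingType.
Implicit Types (S T : R -> Prop) (p q a : R).

Inductive ideal_of S : R -> Prop :=
| ideal_of0 : ideal_of S 0
| ideal_ofMD a s p : S s -> ideal_of S p -> ideal_of S (a * s + p).

Lemma ideal_of_mem S s : S s -> ideal_of S s.
Proof. by move=> Ss; rewrite -[s]mul1r -[_ * _]addr0; do 2?constructor. Qed.

Lemma ideal_ofD S p q : ideal_of S p -> ideal_of S q -> ideal_of S (p + q).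
Proof.
move=> + Iq; elim=> [|a s r Ss _ IH]; first by rewrite add0r.
by rewrite -addrA; constructor.
Qed.

Lemma ideal_ofM S a p : ideal_of S p -> ideal_of S (a * p).
Proof.
elim=> [|b s r Ss _ IH]; first by rewrite mulr0; constructor.
by rewrite mulrDr mulrA; constructor.
Qed.

Lemma ideal_ofN S p : ideal_of S p -> ideal_of S (- p).
Proof. by rewrite -mulN1r; apply: ideal_ofM. Qed.

Lemma ideal_ofB S p q : ideal_of S p -> ideal_of S q -> ideal_of S (p - q).
Proof. by move=> Ip /ideal_ofN; apply: ideal_ofD. Qed.

Lemma ideal_of_sum S (I : Type) (r : seq I) (P : pred I) (F : I -> R) :
  (forall i, P i -> ideal_of S (F i)) -> ideal_of S (\sum_(i <- r | P i) F i).
Proof.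
by move=> IF; elim/big_ind: _ => //; [constructor | move=> *; apply: ideal_ofD].
Qed.

Lemma sub_ideal_of S T : (forall s, S s -> ideal_of T s) ->
  forall p, ideal_of S p -> ideal_of T p.
Proof.
move=> ST p; elim=> [|a s r Ss _ IH]; first by constructor.
by apply: ideal_ofD IH; apply/ideal_ofM/ST.
Qed.

(** The predicate [P] allows subfamilies: initial segments of a sequence for regularity, and all
    rows but one for cofactors. *)
Definition famset n (P : pred 'I_n) (g : 'I_n -> R) (s : R) : Prop :=
  exists2 i, P i & s = g i.

Lemma ideal_famP n (P : pred 'I_n) (g : 'I_n -> R) p :
  ideal_of (famset P g) p <-> exists c, p = \sum_(i | P i) c i * g i.
Proof.
split; last first.
  case=> c ->; apply: ideal_of_sum => i Pi; apply/ideal_ofM/ideal_of_mem.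
  by exists i.
elim=> [|a s q [i Pi ->] _ [c ->]].
  by exists (fun=> 0); rewrite big1 // => i _; rewrite mul0r.
exists (fun j => c j + (if j == i then a else 0)).
under [RHS]eq_bigr do rewrite mulrDl.
rewrite big_split /= addrC; congr (_ + _).
rewrite (bigD1 i) //= eqxx big1 ?addr0 // => j /andP[_ /negPf->].
by rewrite mul0r.
Qed.

(** The determinant is a polynomial in the entries, so the congruence passes through the sums and
    products of the Leibniz formula. *)
Lemma ideal_of_detB S n (A B : 'M[R]_n) :
  (forall i j, ideal_of S (A i j - B i j)) -> ideal_of S (\det A - \det B).
Proof.
move=> AB; pose eqI (x y : R) := ideal_of S (x - y).
apply: (@big_ind2 _ _ eqI) => [|x1 x2 y1 y2 h1 h2|s _].
- by rewrite /eqI subrr; constructor.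
- by rewrite /eqI (_ : _ - _ = (x1 - x2) + (y1 - y2));
    [apply: ideal_ofD | ring].
- rewrite /eqI -mulrBr; apply: ideal_ofM.
  apply: (@big_ind2 _ _ eqI) => [|x1 x2 y1 y2 h1 h2|i _] //.
    by rewrite /eqI subrr; constructor.
  rewrite /eqI (_ : _ - _ = x1 * (y1 - y2) + y2 * (x1 - x2)); last by ring.
  by apply: ideal_ofD; apply: ideal_ofM.
Qed.

End Ideals.

Arguments famset {R n}.

Section Koszul.
Variable R : idomainType.

Lemma cofactor_eq_row n (A B : 'M[R]_n) i :
  (forall k l, k != i -> A k l = B k l) ->
  forall j, cofactor A i j = cofactor B i j.
Proof.
move=> AB j; congr (_ * \det _); apply/matrixP=> k l; rewrite !mxE.
by apply: AB; rewrite eq_sym neq_lift.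
Qed.

Lemma det_row_multiple n (A : 'M[R]_n) i d :
  (forall j, exists c, A i j = c * d) -> exists c, \det A = c * d.
Proof.
move=> dA; rewrite (expand_det_row _ i).
elim/big_ind: _ => [|x y [c ->] [c' ->]|j _].
- by exists 0; rewrite mul0r.
- by exists (c + c'); rewrite mulrDl.
- by have [c ->] := dA j; exists (c * cofactor A i j); ring.
Qed.

Variables (n : nat) (z : 'cV[R]_n).
Hypothesis z_neq0 : forall j, z j 0 != 0.

(** Replacing row [i0] of [W] by the Koszul syzygy with entries [z j 0] at [k] and [- z k 0] at [j]
    gives a matrix [V] whose determinant is the given element, while row [i0] of [V *m z] vanishes.
    Row [j] of [\adj V *m (V *m z) = \det V *: z] then writes [\det V * z j 0] in the remaining
    rows. Every cofactor used there omits column [j], so its row from [i0] keeps only the entry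
    [z j 0]; hence [z j 0] cancels. *)
Lemma koszul_cofactor (W : 'M[R]_n) i0 j k : j != k ->
  ideal_of (famset (predC1 i0) (fun i => (W *m z) i 0))
    (z j 0 * cofactor W i0 k - z k 0 * cofactor W i0 j).
Proof.
move=> njk.
pose r l := if l == k then z j 0 else if l == j then - z k 0 else 0.
pose V := \matrix_(i, l) if i == i0 then r l else W i l.
have VW i l : i != i0 -> V i l = W i l by rewrite mxE => /negPf->.
have Vr l : V i0 l = r l by rewrite mxE eqxx.
have detV : \det V = z j 0 * cofactor W i0 k - z k 0 * cofactor W i0 j.
  rewrite (expand_det_row _ i0) (bigD1 k) //= (bigD1 j) //= big1 => [|l].
    by rewrite !Vr /r eqxx (negPf njk) eqxx !(cofactor_eq_row VW) addr0 mulNr.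
  by case/andP=> /negPf nk /negPf nj; rewrite Vr /r nk nj mul0r.
have Vz0 : (V *m z) i0 0 = 0.
  rewrite mxE (bigD1 k) //= (bigD1 j) //= big1 => [|l].
    by rewrite !Vr /r eqxx (negPf njk) eqxx; ring.
  by case/andP=> /negPf nk /negPf nj; rewrite Vr /r nk nj mul0r.
have Vz i : i != i0 -> (V *m z) i 0 = (W *m z) i 0.
  by move=> ni; rewrite !mxE; apply: eq_bigr => l _; rewrite VW.
have cofV i : i != i0 -> exists c, cofactor V i j = c * z j 0.
  move=> ni; have [i' i'E _] := unlift_some ni.
  suff [c cE] : exists c, \det (row' i (col' j V)) = c * z j 0.
    by exists ((-1) ^+ (i + j) * c); rewrite /cofactor cE mulrA.
  apply: (@det_row_multiple _ _ i') => l; rewrite !mxE -i'E eqxx /r.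
  have /negPf-> : lift j l != j by rewrite eq_sym neq_lift.
  by case: ifP => _; [exists 1; rewrite mul1r | exists 0; rewrite mul0r].
apply/ideal_famP.
have [g gE] : exists g : 'I_n -> R,
    forall i, i != i0 -> cofactor V i j = g i * z j 0.
  apply: (fin_all_exists (P := fun i x => i != i0 -> cofactor V i j = x * z j 0)).
  move=> i; case: eqP => [->|/eqP/cofV[x ->]]; first by exists 0.
  by exists x.
exists g; apply: (mulIf (z_neq0 j)); rewrite -detV.
have /matrixP/(_ j 0) : \adj V *m (V *m z) = \det V *: z.
  by rewrite mulmxA mul_adj_mx mul_scalar_mx.
rewrite [LHS]mxE [RHS]mxE => <-; rewrite (bigD1 i0) //= Vz0 mulr0 add0r.
rewrite mulr_suml; apply: eq_bigr => i ni; rewrite mxE gE // Vz //; ring.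
Qed.

Hypothesis z_reg : forall (k : 'I_n) (p : R),
  ideal_of (famset (fun j : 'I_n => (j < k)%N) (fun j => z j 0)) (p * z k 0) ->
  ideal_of (famset (fun j : 'I_n => (j < k)%N) (fun j => z j 0)) p.

(** Syzygies of a regular sequence are combinations of Koszul ones, which [koszul_cofactor] handles.
    The induction is on a bound [k] for the support of [r]. *)
Lemma syzygy_cofactor (W : 'M[R]_n) i0 (r : 'I_n -> R) :
  \sum_j r j * z j 0 = 0 ->
  ideal_of (famset (predC1 i0) (fun i => (W *m z) i 0))
    (\sum_j r j * cofactor W i0 j).
Proof.
suff: forall k (r : 'I_n -> R), (forall j : 'I_n, (k <= j)%N -> r j = 0) ->
    \sum_j r j * z j 0 = 0 ->
    ideal_of (famset (predC1 i0) (fun i => (W *m z) i 0))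
      (\sum_j r j * cofactor W i0 j).
  by move/(_ n r); apply=> j; rewrite leqNgt ltn_ord.
elim=> [|k IH] {}r r0 rz.
  by rewrite big1; [constructor | move=> j _; rewrite r0 ?mul0r].
case: (ltnP k n) => [lt_kn|le_nk]; last first.
  by apply: IH => // j lekj; apply: r0; move: (leq_trans le_nk lekj); rewrite leqNgt ltn_ord.
pose K := Ordinal lt_kn.
(* The relation puts [r K * z K 0] in the ideal of the earlier entries of [z], and regularity
   removes the factor [z K 0]. *)
have [s sE] : exists s, r K = \sum_(j : 'I_n | (j < K)%N) s j * z j 0.
  apply/ideal_famP/z_reg/ideal_famP; exists (fun j => - r j).
  move: rz; rewrite (bigD1 K) //= => /eqP; rewrite addr_eq0 => /eqP->.
  rewrite -sumrN [RHS]big_mkcond [LHS]big_mkcond /=; apply: eq_bigr => j _.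
  rewrite mulNr; case: (ltngtP j k) => jk.
  - by rewrite -val_eqE /= (ltn_eqF jk).
  - by rewrite -val_eqE /= (gtn_eqF jk) r0 // mul0r oppr0.
  - by rewrite -val_eqE /= jk eqxx.
(* Subtracting the Koszul syzygies between [K] and each [j < k], weighted by [s j], clears position
   [K] and leaves a shorter syzygy. *)
pose r' j := if j == K then 0 else r j + (if (j < k)%N then s j * z K 0 else 0).
have rsplit (F : 'I_n -> R) : \sum_j r j * F j = \sum_j r' j * F j
    + \sum_(j : 'I_n | (j < k)%N) s j * (z j 0 * F K - z K 0 * F j).
  under [X in _ = _ + X]eq_bigr do rewrite mulrBr !mulrA.
  rewrite sumrB -mulr_suml -sE [in LHS](bigD1 K) //= [in RHS](bigD1 K) //=.
  rewrite /r' eqxx mul0r add0r addrCA; congr (_ + _).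
  rewrite [X in _ = _ - X]big_mkcond [X in _ = _ - X](bigD1 K) //= ltnn add0r.
  rewrite -sumrB; apply: eq_bigr => j /negPf->; case: ifP => _; ring.
rewrite rsplit; apply: ideal_ofD.
  apply: IH => [j|].
    rewrite /r' leq_eqVlt => /predU1P[kj|lkj].
      by rewrite -val_eqE /= -kj eqxx.
    by case: ifP => // _; rewrite ltnNge (ltnW lkj) addr0 r0.
  move: rz; rewrite rsplit [X in _ + X]big1 ?addr0 // => j _; ring.
apply: ideal_of_sum => j ltjk; apply/ideal_ofM/koszul_cofactor.
by rewrite -val_eqE /= (ltn_eqF ltjk).
Qed.

(** The rows of [B] are exchanged for those of [A] one at a time. Two consecutive hybrids [T k]
    share all cofactors along the changed row, and the difference of their rows there is a syzygy of
    [z]. *)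
Lemma det_eq_mod_syzygy (A B : 'M[R]_n) : A *m z = B *m z ->
  ideal_of (famset predT (fun i => (A *m z) i 0)) (\det A - \det B).
Proof.
move=> AB; pose T k := \matrix_(i, j) if (i < k)%N then A i j else B i j.
have Tz k : T k *m z = A *m z.
  apply/matrixP=> i j; rewrite (ord1 j); case: (ltnP i k) => ik.
    by rewrite !mxE; apply: eq_bigr => l _; rewrite mxE ik.
  by rewrite AB !mxE; apply: eq_bigr => l _; rewrite mxE ltnNge ik.
have -> : \det A = \det (T n)
  by congr (\det _); apply/matrixP=> i j; rewrite mxE ltn_ord.
suff: forall k, (k <= n)%N ->
    ideal_of (famset predT (fun i => (A *m z) i 0)) (\det (T k) - \det B).
  exact.
elim=> [|k IH] lekn.
  rewrite (_ : T 0%N = B) ?subrr; first by constructor.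
  by apply/matrixP=> i j; rewrite mxE.
rewrite (_ : _ - _ = (\det (T k.+1) - \det (T k)) + (\det (T k) - \det B)); last by ring.
apply: ideal_ofD; last exact/IH/ltnW.
pose K := Ordinal lekn.
have TT i l : i != K -> T k.+1 i l = T k i l.
  by move=> ni; rewrite !mxE ltnS leq_eqVlt -[(i == k :> nat)]/(i == K) (negPf ni).
rewrite !(expand_det_row _ K) -sumrB.
under eq_bigr do rewrite (cofactor_eq_row TT) -mulrBl.
apply: (sub_ideal_of (S := famset (predC1 K) (fun i => (T k *m z) i 0))).
  by move=> s [i _ ->]; apply: ideal_of_mem; exists i; rewrite // Tz.
apply: syzygy_cofactor.
under eq_bigr do rewrite mulrBl.
rewrite sumrB; apply/eqP; rewrite subr_eq0; apply/eqP.
by move: (congr1 (fun M : 'cV_n => M K 0) (etrans (Tz k.+1) (esym (Tz k)))); rewrite !mxE.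
Qed.

End Koszul.

(** * Traces and nilpotent matrices *)

Section NilpotentTrace.
Variable F : fieldType.

(* With N = C *m B a full-rank factorization, B *m C is a nilpotent matrix of
   smaller size and has the same trace. *)
Lemma mxtrace_nilpotent n (N : 'M[F]_n) k : N ^+ k = 0 -> \tr N = 0.
Proof.
elim/ltn_ind: n => n IH in N k *.
case: (posnP n) => [n0 _|n_gt0 Nk].
  by rewrite /mxtrace big1 // => i _; move: (ltn_ord i); rewrite {2}n0.
have rN : (\rank N < n)%N.
  rewrite ltn_neqAle rank_leq_row andbT; apply/negP => rn.
  suff rNk : \rank (N ^+ k) = n.
    by move: n_gt0; rewrite -rNk Nk mxrank0.
  elim: k {Nk} => [|k IHk]; first by rewrite mxrank1.
  by rewrite exprSr -[_ * _]/(_ *m _) mxrankMfree.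
rewrite -(mulmx_base N) mxtrace_mulC.
set C := col_base N; set B := row_base N.
have BCk j : C *m (B *m C) ^+ j = N ^+ j *m C.
  elim: j => [|j IHj]; first by rewrite mulmx1 mul1mx.
  rewrite exprSr -[_ * _]/(_ *m _) mulmxA IHj -mulmxA (mulmxA C) mulmx_base.
  by rewrite exprSr -[_ * N]/(_ *m N) mulmxA.
apply: (IH _ rN _ k.+1) => /=.
by rewrite exprS -[_ * _]/(_ *m _) -mulmxA BCk Nk mul0mx mulmx0.
Qed.

(** In a full-rank factorization [e = C *m B], idempotency reads [C *m B *m C *m B = C *m B];
    cancelling the outer factors leaves [B *m C = 1]. *)
Lemma mxtrace_idempotent n (e : 'M[F]_n) :
  e *m e = e -> \tr e = (\rank e)%:R.
Proof.
move=> ee; rewrite -{1}(mulmx_base e) mxtrace_mulC.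
move: (row_base_free e) (col_base_full e) (mulmx_base e).
move: (row_base e) (col_base e) => B C freeB fullC CB.
suff -> : B *m C = 1%:M by rewrite mxtrace1.
apply: (row_free_inj freeB); apply: (row_full_inj fullC).
by rewrite /= mul1mx !mulmxA CB -mulmxA CB.
Qed.

(* Fitting: if M is not nilpotent then M times some polynomial in M is a
   nonzero idempotent, whose trace is a positive integer. *)
Lemma nilpotent_of_mxtrace n (M : 'M[F]_n.+1) : [pchar F] =i pred0 ->
  (forall k, \tr (M ^+ k.+1) = 0) -> exists k, M ^+ k = 0.
Proof.
move=> char0 trM.
have trM0 p : \tr (M * horner_mx M p) = 0.
  suff trq q k : \tr (M ^+ k.+1 * horner_mx M q) = 0 by rewrite -[M]expr1 trq.
  elim/poly_ind: q k => [|q d IHq] k; first by rewrite rmorph0 mulr0 mxtrace0.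
  rewrite rmorphD rmorphM /= horner_mx_X horner_mx_C mulrDr mxtraceD.
  have -> : horner_mx M q * M = M * horner_mx M q by apply: comm_horner_mx.
  rewrite mulrA -exprSr IHq.
  by rewrite add0r -[_ * _]/(_ *m _) mul_mx_scalar mxtraceZ trM mulr0.
have [k [u nu uE]] := multiplicity_XsubC (char_poly M) 0.
have chi0 : char_poly M != 0 by rewrite monic_neq0 ?char_poly_monic.
rewrite chi0 /= subr0 in nu uE.
(* The exponent [k.+1], instead of the multiplicity [k] of the root 0, keeps a factor [M] in [e]
   even when [k] is 0, so that [trM0] applies to [e]. *)
have copr : coprimep ('X^(k.+1)) u.
  by rewrite coprimep_expl // coprimep_sym coprimepX.
have /Bezout_eq1_coprimepP[[a b] /= ab1] := copr.
have Mu : M ^+ k.+1 * horner_mx M u = 0.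
  have := Cayley_Hamilton M; rewrite uE mulrC rmorphM /= rmorphXn /= horner_mx_X.
  by move=> h; rewrite exprS -mulrA h mulr0.
pose e := horner_mx M (a * 'X^(k.+1)).
have Mku : horner_mx M 'X^(k.+1) = M ^+ k.+1 by rewrite rmorphXn /= horner_mx_X.
have bu : horner_mx M (b * u) = 1 - e.
  by rewrite -[1](rmorph1 (horner_mx M)) -ab1 rmorphD /= addrC addKr.
have e0 : horner_mx M 'X^(k.+1) * (1 - e) = 0.
  by rewrite -bu -rmorphM mulrCA mulrC rmorphM rmorphM /= Mku Mu mul0r.
have ee : e *m e = e.
  apply/eqP; rewrite eq_sym -subr_eq0 -[_ *m _]/(e * e) -{1}[e]mulr1 -mulrBr.
  by rewrite {1}/e rmorphM /= -mulrA e0 mulr0.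
have /eqP : \tr e = 0 by rewrite /e exprS mulrCA rmorphM /= horner_mx_X trM0.
rewrite mxtrace_idempotent // (pcharf0P F).1 // mxrank_eq0 => /eqP e00.
by exists k.+1; rewrite -Mku; move: e0; rewrite e00 subr0 mulr1.
Qed.

End NilpotentTrace.

(** * Discrete derivatives and Bezoutians *)

Lemma mpoly_alg_ind (R : comNzRingType) n (P : {mpoly R[n]} -> Prop) :
  (forall c, P c%:MP) -> (forall i, P 'X_i) ->
  (forall p q, P p -> P q -> P (p + q)) ->
  (forall p q, P p -> P q -> P (p * q)) -> forall p, P p.
Proof.
move=> PC PX PD PM; have PXm (a : 'X_{1..n}) : P 'X_[a].
  rewrite mpolyXE_id; elim/big_ind: _ => // [|i _].
    by rewrite -mpolyC1.
  by elim: (a i) => [|k IH]; rewrite ?expr0 -?mpolyC1 // exprS; apply: PM.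
elim/mpolyind => [|c a p _ _ Pp]; first by rewrite -mpolyC0.
by apply: PD => //; rewrite -mul_mpolyC; apply: PM.
Qed.

HB.instance Definition _ (K : fieldType) m i :=
  GRing.RMorphism.copy (@evalX K m i) (comp_mpoly (Xpt K m i)).
HB.instance Definition _ (K : fieldType) m i :=
  GRing.Linear.copy (@evalX K m i) (comp_mpoly (Xpt K m i)).

Section DiscreteDerivatives.
Variables (K : fieldType) (m : nat).
Implicit Types (f g : {mpoly K[m]}) (Q : {mpoly K[m + m]}) (i j k : 'I_m).

Local Notation zvar j := (xvar K j - yvar K j).

Lemma evalXU n j : evalX n 'X_j = if (j < n)%N then yvar K j else xvar K j.
Proof.
by rewrite /evalX comp_mpolyXU -tnth_nth tnth_mktuple.
Qed.

Lemma evalXC n c : evalX n (c%:MP : {mpoly K[m]}) = c%:MP.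
Proof. exact: comp_mpolyC. Qed.

Definition diag_tuple : (m + m).-tuple {mpoly K[m]} :=
  [tuple match split i with inl j => 'X_j | inr j => 'X_j end | i < m + m].

Definition diag Q : {mpoly K[m]} := Q \mPo diag_tuple.
HB.instance Definition _ := GRing.RMorphism.copy diag (comp_mpoly diag_tuple).
HB.instance Definition _ := GRing.Linear.copy diag (comp_mpoly diag_tuple).

Lemma diag_xvar j : diag (xvar K j) = 'X_j.
Proof.
by rewrite /diag comp_mpolyXU -tnth_nth tnth_mktuple (unsplitK (inl j)).
Qed.

Lemma diag_yvar j : diag (yvar K j) = 'X_j.
Proof.
by rewrite /diag comp_mpolyXU -tnth_nth tnth_mktuple (unsplitK (inr j)).
Qed.

Lemma diag_evalX n f : diag (evalX n f) = f.
Proof.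
elim/mpoly_alg_ind: f => [c|j|p q IHp IHq|p q IHp IHq].
- by rewrite evalXC /diag comp_mpolyC.
- by rewrite evalXU; case: ifP => _; rewrite ?diag_xvar ?diag_yvar.
- by rewrite !rmorphD /= IHp IHq.
- by rewrite !rmorphM /= IHp IHq.
Qed.

Lemma zvar_neq0 j : zvar j != 0.
Proof.
apply/eqP => /(congr1 (mcoeff U_(lshift m j))); rewrite mcoeffB !mcoeffX mcoeff0.
rewrite eqxx; case: eqP => [/(congr1 (fun a : 'X_{1..m + m} => a (lshift m j)))|_].
  by rewrite !mnm1E eqxx eq_rlshift.
by move/eqP; rewrite subr0 oner_eq0.
Qed.

Definition theta f j : {mpoly K[m + m]} :=
  exdiv (evalX j f - evalX j.+1 f) (zvar j).

(** A quotient with both properties is built by induction on [f]. It is unique because [zvar j] is a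
    nonzero element of a domain, so it is the one chosen by epsilon. *)
Lemma theta_spec f j :
  theta f j * zvar j = evalX j f - evalX j.+1 f /\ diag (theta f j) = f^`M(j).
Proof.
have [q [qE qd]] : exists q, q * zvar j = evalX j f - evalX j.+1 f
    /\ diag q = f^`M(j).
  elim/mpoly_alg_ind: f => [c|i|p q [a [aE ad]] [b [bE bd]]
                           |p q [a [aE ad]] [b [bE bd]]].
  - by exists 0; rewrite mul0r !evalXC subrr rmorph0 mderivC.
  - exists (i == j)%:R; rewrite rmorph_nat mderivX !evalXU; split; last first.
      rewrite mnm1E; case: eqP => [->|_]; last by rewrite scale0r.
      by rewrite -{1}[U_(j)%MM]add0m addmK mpolyX0 scale1r.
    rewrite ltnS -val_eqE /=; case: (ltngtP i j) => [ij|ij|/val_inj->].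
    - by rewrite mul0r subrr.
    - by rewrite mul0r subrr.
    - by rewrite mul1r.
  - exists (a + b); rewrite !rmorphD /= ad bd mderivD mulrDl aE bE; split=> //.
    by ring.
  (* Discrete Leibniz rule: one factor is evaluated before the [j]-th substitution and the other
     after it. *)
  - exists (a * evalX j q + evalX j.+1 p * b).
    rewrite !rmorphD !rmorphM /= !diag_evalX ad bd mderivM; split=> //.
    by rewrite mulrDl -mulrA (mulrC _ (zvar j)) mulrA aE -mulrA bE; ring.
have tE : theta f j * zvar j = evalX j f - evalX j.+1 f.
  apply: (epsilon_spec (inhabits 0)
    (fun q => q * zvar j = evalX j f - evalX j.+1 f)).
  by exists q.
by split=> //; rewrite -qd; congr diag; apply: (mulIf (zvar_neq0 j)); rewrite tE.
Qed.

Lemma theta_sum f : \sum_j theta f j * zvar j = evalX 0 f - evalX m f.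
Proof.
under eq_bigr do rewrite (theta_spec _ _).1.
rewrite -(big_mkord predT (fun l : nat => evalX l f - evalX l.+1 f)).
rewrite -[LHS]opprK -sumrN; under eq_bigr do rewrite opprB.
by rewrite telescope_sumr // opprB.
Qed.

Lemma theta1 j : theta 1 j = 0.
Proof.
apply: (mulIf (zvar_neq0 j)).
by rewrite (theta_spec _ _).1 !rmorph1 subrr mul0r.
Qed.

Definition theta_mx (f : 'I_m -> {mpoly K[m]}) : 'M[{mpoly K[m + m]}]_m :=
  \matrix_(i, j) theta (f i) j.

Lemma row'_col'_bezout_mx f0 (f : 'I_m -> {mpoly K[m]}) :
  row' ord0 (col' ord0 (bezout_mx f0 f)) = theta_mx f.
Proof. by apply/matrixP=> i j; rewrite !mxE /fam !liftK. Qed.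

(** The row of the constant 1 is [(1, 0, ..., 0)]. *)
Lemma bezoutian1 (f : 'I_m -> {mpoly K[m]}) : bezoutian 1 f = \det (theta_mx f).
Proof.
rewrite /bezoutian (expand_det_row _ ord0) big_ord_recl big1 => [|j _].
  by rewrite /cofactor row'_col'_bezout_mx !mxE /fam !unlift_none rmorph1
    mul1r addr0 expr0 mul1r.
by rewrite mxE /fam unlift_none liftK -/(theta 1 j) theta1 mul0r.
Qed.

Lemma diag_bezoutian1 (f : 'I_m -> {mpoly K[m]}) : diag (bezoutian 1 f) = jacobian f.
Proof.
rewrite bezoutian1 -det_map_mx; congr (\det _); apply/matrixP=> i j.
by rewrite !mxE; exact: (theta_spec _ _).2.
Qed.

(** Expansion along the first column, whose entries below [f0] are the [f i] in the variables
    [x]. *)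
Lemma bezoutian_x f0 (f : 'I_m -> {mpoly K[m]}) :
  ideal_of (famset predT (fun i => evalX 0 (f i)))
    (bezoutian f0 f - evalX 0 f0 * bezoutian 1 f).
Proof.
rewrite bezoutian1 /bezoutian (expand_det_col _ ord0) big_ord_recl.
rewrite /cofactor row'_col'_bezout_mx !mxE /fam !unlift_none expr0 mul1r.
rewrite addrC addKr; apply: ideal_of_sum => i _; rewrite mulrC; apply: ideal_ofM.
by apply: ideal_of_mem; exists i; rewrite // mxE unlift_none /fam liftK.
Qed.

(** The unimodular [U] subtracts from the first column each other column times its [zvar j]. By
    telescoping, this turns the values at [X_0] into values at [X_m]; then the first column is
    expanded. *)
Lemma bezoutian_y f0 (f : 'I_m -> {mpoly K[m]}) :
  ideal_of (famset predT (fun i => evalX m (f i)))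
    (bezoutian f0 f - evalX m f0 * bezoutian 1 f).
Proof.
pose g := fam f0 f.
pose A := bezout_mx f0 f.
pose U : 'M[{mpoly K[m + m]}]_m.+1 := \matrix_(k, l)
  match unlift ord0 k, unlift ord0 l with
  | None, None => 1
  | None, Some _ => 0
  | Some j, None => - zvar j
  | Some j, Some j' => (j == j')%:R
  end.
have detU : \det U = 1.
  rewrite (expand_det_row _ ord0) big_ord_recl big1 => [|j _].
    rewrite mxE unlift_none mul1r addr0 /cofactor expr0 mul1r.
    rewrite (_ : row' _ _ = 1%:M) ?det1 //.
    by apply/matrixP=> i j; rewrite !mxE !liftK.
  by rewrite mxE unlift_none liftK mul0r.
have AU0 (i : 'I_m.+1) : (A *m U) i ord0 = evalX m (g i).
  rewrite mxE big_ord_recl !mxE unlift_none mulr1.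
  rewrite (eq_bigr (fun j => - (theta (g i) j * zvar j))) => [|j _].
    by rewrite sumrN theta_sum opprB addrC subrK.
  by rewrite !mxE liftK unlift_none mulrN.
have AUS (i : 'I_m.+1) j : (A *m U) i (lift ord0 j) = theta (g i) j.
  rewrite mxE big_ord_recl !mxE unlift_none liftK mulr0 add0r.
  rewrite (bigD1 j) //= big1 => [|l nl].
    by rewrite !mxE !liftK eqxx mulr1 addr0.
  by rewrite !mxE !liftK (negPf nl) mulr0.
have -> : bezoutian f0 f = \det (A *m U) by rewrite det_mulmx detU mulr1.
rewrite bezoutian1 (expand_det_col _ ord0) big_ord_recl AU0 /g /fam unlift_none.
have -> : cofactor (A *m U) ord0 ord0 = \det (theta_mx f).
  rewrite /cofactor expr0 mul1r; congr (\det _); apply/matrixP=> i j.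
  by rewrite mxE mxE AUS mxE /g /fam liftK.
rewrite addrC addKr; apply: ideal_of_sum => i _; rewrite mulrC; apply: ideal_ofM.
by apply: ideal_of_mem; exists i; rewrite // AU0 /g /fam liftK.
Qed.

(** The substitution [y_j := x_j] for [j < n], a model of the quotient by the first [n] differences
    inside the polynomial ring itself. *)
Definition collapse_tuple n : (m + m).-tuple {mpoly K[m + m]} :=
  [tuple match split i with
         | inl j => xvar K j
         | inr j => if (j < n)%N then xvar K j else yvar K j end | i < m + m].

Lemma collapse_xvar n j : xvar K j \mPo collapse_tuple n = xvar K j.
Proof.
by rewrite comp_mpolyXU -tnth_nth tnth_mktuple (unsplitK (inl j)).
Qed.

Lemma collapse_yvar n j :
  yvar K j \mPo collapse_tuple n = if (j < n)%N then xvar K j else yvar K j.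
Proof.
by rewrite comp_mpolyXU -tnth_nth tnth_mktuple (unsplitK (inr j)).
Qed.

(** The collapse kills the ideal and is the identity modulo it, so its kernel is exactly the ideal.
    Its values lie in a domain, and it fixes [zvar k], which is nonzero. *)
Lemma zvar_regular k (p : {mpoly K[m + m]}) :
  ideal_of (famset (fun j => (j < k)%N) (fun j => zvar j)) (p * zvar k) ->
  ideal_of (famset (fun j => (j < k)%N) (fun j => zvar j)) p.
Proof.
set I := ideal_of _ => Ipz.
have I0 q : I q -> q \mPo collapse_tuple k = 0.
  elim=> [|a s r [j jk ->] _ IH]; first exact: rmorph0.
  rewrite rmorphD rmorphM rmorphB /= IH collapse_xvar collapse_yvar jk.
  by rewrite subrr mulr0 addr0.
have Iq q : I (q - (q \mPo collapse_tuple k)).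
  elim/mpoly_alg_ind: q => [c|i|q r Iq Ir|q r Iq Ir].
  - by rewrite comp_mpolyC subrr; constructor.
  - rewrite -(splitK i); case: (split i) => j /=.
      by rewrite -/(xvar K j) collapse_xvar subrr; constructor.
    rewrite -/(yvar K j) collapse_yvar; case: ifP => jk.
      by rewrite -opprB; apply/ideal_ofN/ideal_of_mem; exists j.
    by rewrite subrr; constructor.
  - by rewrite rmorphD opprD addrACA; apply: ideal_ofD.
  - rewrite rmorphM /=; set q' := q \mPo _; set r' := r \mPo _.
    rewrite (_ : _ - _ = q * (r - r') + r' * (q - q')); last by ring.
    by apply: ideal_ofD; apply: ideal_ofM.
have := I0 _ Ipz; rewrite rmorphM rmorphB /= collapse_xvar collapse_yvar ltnn.
move/eqP; rewrite mulf_eq0 (negPf (zvar_neq0 k)) orbF => /eqP p0.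
by have := Iq p; rewrite p0 subr0.
Qed.

End DiscreteDerivatives.

(** * Applying functionals to the second set of variables *)

Lemma in_idealP (K : fieldType) m (f : 'I_m -> {mpoly K[m]}) p :
  in_ideal f p <-> ideal_of (famset predT f) p.
Proof. by split=> [[g ->]|/ideal_famP[g ->]]; [apply/ideal_famP | ]; exists g. Qed.

Section MonomialSums.
Variables (K : fieldType) (n : nat) (V : lmodType K) (F : 'X_{1..n} -> V).
Implicit Type p : {mpoly K[n]}.

Definition mext p : V := \sum_(a <- msupp p) p@_a *: F a.

Lemma mextE (s : seq 'X_{1..n}) p : uniq s -> {subset msupp p <= s} ->
  mext p = \sum_(a <- s) p@_a *: F a.
Proof.
move=> us sub; rewrite (bigID (mem (msupp p))) /= [X in _ = _ + X]big1 => [|a].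
  rewrite addr0 -big_filter; apply: perm_big; apply: uniq_perm => //.
    exact: filter_uniq.
  by move=> a; rewrite mem_filter; case: (boolP (a \in msupp p)) => // /sub->.
by move/memN_msupp_eq0->; rewrite scale0r.
Qed.

Lemma mext_is_linear : linear mext.
Proof.
move=> c p q; pose s := undup (msupp (c *: p + q) ++ msupp p ++ msupp q).
have us : uniq s by rewrite undup_uniq.
rewrite !(@mextE s) //; try by move=> a ha; rewrite mem_undup !mem_cat ha ?orbT.
rewrite scaler_sumr -big_split /=; apply: eq_bigr => a _.
by rewrite mcoeffD mcoeffZ scalerDl scalerA.
Qed.
HB.instance Definition _ := GRing.isLinear.Build K {mpoly K[n]} V _ mext
  mext_is_linear.

Lemma mextX a : mext 'X_[a] = F a.
Proof. by rewrite /mext msuppX big_seq1 mcoeffX eqxx scale1r. Qed.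

End MonomialSums.

Lemma eq_mext (K : fieldType) n (V : lmodType K) (F G : 'X_{1..n} -> V) :
  F =1 G -> mext F =1 mext G.
Proof. by move=> FG p; apply: eq_bigr => a _; rewrite FG. Qed.

Section Twist.
Variables (K : fieldType) (m : nat) (L : {scalar {mpoly K[m]}}) (p : {mpoly K[m]}).

Definition twist (q : {mpoly K[m]}) : K := L (p * q).

Lemma twist_is_linear : linear_for *%R twist.
Proof. by move=> c q r; rewrite /twist mulrDr -scalerAr linearP. Qed.
HB.instance Definition _ := GRing.isLinear.Build K {mpoly K[m]} K _ twist
  twist_is_linear.

End Twist.

Section Slice.
Variables (K : fieldType) (m : nat).
Implicit Types (p q : {mpoly K[m]}) (Q : {mpoly K[m + m]}) (lam : 'X_{1..m} -> K).

Definition mfst (c : 'X_{1..m + m}) : 'X_{1..m} := [multinom c (lshift m i) | i < m].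
Definition msnd (c : 'X_{1..m + m}) : 'X_{1..m} := [multinom c (rshift m i) | i < m].

Lemma mcatK c : mcat (mfst c) (msnd c) = c.
Proof.
apply/mnmP=> i; rewrite mnmE -[in RHS](splitK i); case: (split i) => j /=.
  by rewrite mnmE.
by rewrite mnmE.
Qed.

Lemma mfst_mcat a b : mfst (mcat a b) = a.
Proof. by apply/mnmP=> i; rewrite !mnmE (unsplitK (inl i)). Qed.

Lemma msnd_mcat a b : msnd (mcat a b) = b.
Proof. by apply/mnmP=> i; rewrite !mnmE (unsplitK (inr i)). Qed.

Lemma mfstD c d : mfst (c + d)%MM = (mfst c + mfst d)%MM.
Proof. by apply/mnmP=> i; rewrite !mnmE. Qed.

Lemma msndD c d : msnd (c + d)%MM = (msnd c + msnd d)%MM.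
Proof. by apply/mnmP=> i; rewrite !mnmE. Qed.

Lemma evalX0X (a : 'X_{1..m}) :
  evalX 0 ('X_[a] : {mpoly K[m]}) = 'X_[mcat a 0%MM].
Proof.
rewrite /evalX comp_mpolyX mpolyXE_id big_split_ord /=.
rewrite [X in _ = _ * X]big1 => [|i _].
  rewrite mulr1; apply: eq_bigr => i _.
  by rewrite tnth_mktuple mnmE (unsplitK (inl i)).
by rewrite mnmE (unsplitK (inr i)) mnm0E expr0.
Qed.

Lemma evalXmX (a : 'X_{1..m}) :
  evalX m ('X_[a] : {mpoly K[m]}) = 'X_[mcat 0%MM a].
Proof.
rewrite /evalX comp_mpolyX mpolyXE_id big_split_ord /=.
rewrite [X in _ = X * _]big1 => [|i _].
  rewrite mul1r; apply: eq_bigr => i _.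
  by rewrite tnth_mktuple mnmE (unsplitK (inr i)) ltn_ord.
by rewrite mnmE (unsplitK (inl i)) mnm0E expr0.
Qed.

(* [slice lam Q] applies the functional [y^b |-> lam b] to the [y]-variables. *)
Definition slice lam : {mpoly K[m + m]} -> {mpoly K[m]} :=
  mext (fun c => lam (msnd c) *: 'X_[mfst c]).
HB.instance Definition _ lam := GRing.Linear.copy (slice lam)
  (mext (fun c => lam (msnd c) *: 'X_[mfst c])).

Lemma sliceX lam c : slice lam 'X_[c] = lam (msnd c) *: 'X_[mfst c].
Proof. exact: mextX. Qed.

Lemma eq_slice lam lam' : lam =1 lam' -> slice lam =1 slice lam'.
Proof. by move=> e; apply: eq_mext => c; rewrite e. Qed.

Lemma slice_xM lam p Q : slice lam (evalX 0 p * Q) = p * slice lam Q.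
Proof.
rewrite [p]mpolyE !linear_sum !mulr_suml linear_sum /=; apply: eq_bigr => a _.
rewrite [Q]mpolyE !linear_sum !mulr_sumr linear_sum /=; apply: eq_bigr => c _.
rewrite !linearZ /= -!scalerAl -!scalerAr !linearZ /= !scalerA mulrC; congr (_ *: _).
rewrite evalX0X -mpolyXD !sliceX mfstD msndD mfst_mcat msnd_mcat add0m.
by rewrite mpolyXD -scalerAr.
Qed.

Lemma slice_yM (L : {scalar {mpoly K[m]}}) q Q :
  slice (fun b => L 'X_[b]) (evalX m q * Q) = slice (fun b => L (q * 'X_[b])) Q.
Proof.
rewrite [Q]mpolyE !mulr_sumr !linear_sum /=; apply: eq_bigr => c _.
rewrite -scalerAr !linearZ /=; congr (_ *: _); rewrite sliceX.
rewrite [q]mpolyE !linear_sum !mulr_suml !linear_sum /= scaler_suml.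
apply: eq_bigr => a _.
rewrite linearZ /= -!scalerAl !linearZ /= evalXmX -!mpolyXD sliceX -scalerA.
by rewrite mfstD msndD mfst_mcat msnd_mcat add0m.
Qed.

Lemma slice_ideal_x lam (f : 'I_m -> {mpoly K[m]}) Q :
  ideal_of (famset predT (fun i => evalX 0 (f i))) Q ->
  ideal_of (famset predT f) (slice lam Q).
Proof.
elim=> [|a s R [i _ ->] _ IH]; first by rewrite linear0; constructor.
rewrite linearD /= mulrC slice_xM mulrC; constructor => //; by exists i.
Qed.

Lemma slice_ideal_y (L : {scalar {mpoly K[m]}}) (f : 'I_m -> {mpoly K[m]}) Q :
  (forall i q, L (f i * q) = 0) ->
  ideal_of (famset predT (fun i => evalX m (f i))) Q ->
  slice (fun b => L 'X_[b]) Q = 0.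
Proof.
move=> Lf; elim=> [|a s R [i _ ->] _ IH]; first by rewrite linear0.
rewrite linearD /= IH addr0 mulrC slice_yM.
by rewrite (eq_slice (lam' := fun=> 0)) => [|b]; rewrite ?Lf // /slice /mext
  big1 // => c _; rewrite scale0r scaler0.
Qed.

Lemma mpoly_xyE Q : Q = \sum_(c <- msupp Q)
  evalX 0 (Q@_c *: 'X_[mfst c]) * evalX m 'X_[msnd c].
Proof.
rewrite {1}[Q]mpolyE; apply: eq_bigr => c _.
rewrite linearZ /= evalX0X evalXmX -scalerAl -mpolyXD; congr (_ *: 'X_[_]).
rewrite -{1}(mcatK c); apply/mnmP=> i; rewrite mnmDE !mnmE.
by case: (split i) => j; rewrite mnm0E ?addn0 ?add0n.
Qed.

(** The pairs from [E] and [E'] enumerate without repetition a set containing the support, so the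
    result does not depend on the choice of these sets. *)
Lemma bez_applyE f0 (f : 'I_m -> {mpoly K[m]}) (E E' : seq 'X_{1..m}) lam :
  uniq E -> uniq E' ->
  (forall a b, bcoef f0 f a b != 0 -> a \in E /\ b \in E') ->
  bez_apply f0 f E E' lam = slice lam (bezoutian f0 f).
Proof.
move=> uE uE' sub; pose s := [seq mcat a b | a <- E, b <- E'].
rewrite /slice (@mextE _ _ _ _ s).
- rewrite /s big_allpairs_dep /=; apply: eq_bigr => a _; apply: eq_bigr => b _.
  by rewrite mfst_mcat msnd_mcat scalerA.
- apply: allpairs_uniq => // -[a b] [a' b'] _ _ /= e.
  by rewrite -(mfst_mcat a b) e mfst_mcat -{1}(msnd_mcat a b) e msnd_mcat.
- move=> c; rewrite mcoeff_msupp -{1}(mcatK c) => /sub[aE bE].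
  by apply/allpairsP; exists (mfst c, msnd c); rewrite mcatK.
Qed.

End Slice.

(** * The residue of a separated system and the transformation law *)

Section SeparatedResidue.
Variables (K : fieldType) (m n : nat) (P : 'I_m -> {poly K}).
Hypothesis monP : forall i, P i \is monic.
Hypothesis sizeP : forall i, size (P i) = n.+2.

Local Notation zvar j := (xvar K j - yvar K j).

Definition sep_poly i : {mpoly K[m]} := \sum_(k < n.+2) (P i)`_k *: 'X_i ^+ k.

(** The global one-variable residue of ['X^b / P i]: as [P i] is monic of degree [n + 1], it is the
    top coefficient of the remainder. *)
Definition sep_coef i b : K := ('X^b %% P i)`_n.

Definition sep_mon (a : 'X_{1..m}) : K := \prod_i sep_coef i (a i).

(* The Kronecker product of the functionals "coefficient of [X^n] modulo [P i]". *)
Definition sep_residue (p : {mpoly K[m]}) : K := mext (sep_mon : _ -> K^o) p.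

Lemma sep_residue_is_linear : linear_for *%R sep_residue.
Proof. by move=> c p q; rewrite /sep_residue linearP. Qed.
HB.instance Definition _ := GRing.isLinear.Build K {mpoly K[m]} K _ sep_residue
  sep_residue_is_linear.

Lemma sep_residueX a : sep_residue 'X_[a] = sep_mon a.
Proof. by rewrite /sep_residue mextX. Qed.

Lemma sep_coef_small i b : (b <= n)%N -> sep_coef i b = (b == n)%:R.
Proof.
by move=> bn; rewrite /sep_coef modp_small ?coefXn 1?eq_sym // size_polyXn sizeP.
Qed.

Lemma sep_coef_sum i b : \sum_(k < n.+2) (P i)`_k * sep_coef i (k + b) = 0.
Proof.
have PE : \sum_(k < n.+2) (P i)`_k *: 'X^(k + b) = P i * 'X^b.
  rewrite -[in RHS](coefK (P i)) sizeP poly_def mulr_suml.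
  by apply: eq_bigr => k _; rewrite exprD scalerAl.
transitivity ((P i * 'X^b %% P i)`_n); last by rewrite mulrC modp_mull coef0.
rewrite -PE (big_morph _ (modpD (P i)) (mod0p _)) coef_sum.
by apply: eq_bigr => k _; rewrite modpZl coefZ.
Qed.

Lemma sep_residue_poly i q : sep_residue (sep_poly i * q) = 0.
Proof.
rewrite [q]mpolyE mulr_sumr linear_sum big1 // => a _.
rewrite -scalerAr linearZ /= /sep_poly mulr_suml linear_sum /=.
rewrite (eq_bigr (fun k : 'I_n.+2 => (P i)`_k * sep_coef i (k + a i)
                * \prod_(j | j != i) sep_coef j (a j))) => [|k _].
  by rewrite -mulr_suml sep_coef_sum mul0r mulr0.
rewrite -scalerAl linearZ /= mpolyXn -mpolyXD sep_residueX /sep_mon (bigD1 i) //=.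
rewrite mnmDE mulmnE mnm1E eqxx mul1n mulrA; congr (_ * _).
apply: eq_bigr => j ji; rewrite mnmDE mulmnE mnm1E eq_sym (negPf ji) mul0n.
by rewrite add0n.
Qed.

(** The Horner polynomial of [P i]: the coefficient of [y^b] in the divided difference of [P i]
    between [x] and [y]. *)
Definition sep_factor i b : {mpoly K[m]} :=
  \sum_(k < n.+2 | (b < k)%N) (P i)`_k *: 'X_i ^+ (k.-1 - b).

Definition sep_dd i : {mpoly K[m + m]} :=
  \sum_(b < n.+1) evalX 0 (sep_factor i b) * yvar K i ^+ b.

Lemma sep_ddE i :
  sep_dd i * zvar i = evalX 0 (sep_poly i) - evalX m (sep_poly i).
Proof.
rewrite /sep_poly !rmorph_sum -sumrB /=.
have xE : evalX 0 'X_i = xvar K i by rewrite evalXU.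
have yE : evalX m 'X_i = yvar K i by rewrite evalXU ltn_ord.
under [RHS]eq_bigr => k _ do rewrite !linearZ /= !rmorphXn /= xE yE -scalerDr
  subrXX [_ * \sum_(_ < _) _]mulrC scalerAl.
rewrite -mulr_suml; congr (_ * _).
rewrite /sep_dd; under eq_bigr do rewrite linear_sum big_mkcond mulr_suml /=.
rewrite exchange_big /=; apply: eq_bigr => k _.
rewrite scaler_sumr -(big_mkord predT (fun b : nat => (if (b < k)%N then
  evalX 0 ((P i)`_k *: 'X_i ^+ (k.-1 - b)) else 0) * yvar K i ^+ b)).
rewrite (big_cat_nat (n := k)) //= 1?[X in _ + X]big_nat 1?[X in _ + X]big1.
- rewrite addr0 big_mkord; apply: eq_bigr => b _; rewrite ltn_ord linearZ /=.
  by rewrite rmorphXn /= xE scalerAl.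
- by move=> b /andP[kb _]; rewrite ltnNge kb mul0r.
- by rewrite -ltnS.
Qed.

(** The residue is a product over the variables. In each of them, among exponents up to [n], it sees
    only [y^n], whose coefficient in the divided difference is the leading coefficient 1. *)
Lemma slice_sep_dd :
  slice (fun b => sep_residue 'X_[b]) (\prod_i sep_dd i) = 1.
Proof.
rewrite bigA_distr_bigA linear_sum /=.
transitivity (\sum_(phi : {ffun 'I_m -> 'I_n.+1})
    \prod_i (sep_coef i (phi i) *: sep_factor i (phi i))).
  apply: eq_bigr => phi _; rewrite big_split /= -rmorph_prod slice_xM.
  have -> : \prod_i yvar K i ^+ phi i
      = evalX m 'X_[[multinom (phi i : nat) | i < m]].
    rewrite mpolyXE_id rmorph_prod; apply: eq_bigr => i _ /=.
    by rewrite rmorphXn /= evalXU ltn_ord mnmE.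
  rewrite evalXmX sliceX msnd_mcat mfst_mcat mpolyX0 -scalerAr mulr1 scaler_prod.
  congr (_ *: _); rewrite sep_residueX; apply: eq_bigr => i _; by rewrite mnmE.
rewrite -(bigA_distr_bigA (fun i (b : 'I_n.+1) => sep_coef i b *: sep_factor i b)).
apply: big1 => i _; rewrite big_ord_recr /= big1 => [|b _]; last first.
  by rewrite sep_coef_small 1?ltnW ?ltn_ord // ltn_eqF ?scale0r.
rewrite sep_coef_small // eqxx scale1r add0r /sep_factor big_mkcond big_ord_recr /=.
rewrite ltnSn subnn expr0 big1 ?add0r => [|k _]; last first.
  by rewrite ltnNge -ltnS ltn_ord.
by have := monP i; rewrite monicE lead_coefE sizeP => /eqP->; rewrite scale1r.
Qed.

Variables (f : 'I_m -> {mpoly K[m]}) (M : 'M[{mpoly K[m]}]_m).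
Hypothesis PM : forall i, sep_poly i = \sum_j M i j * f j.

(** The transformation law for residues, taken as the definition of the residue of [f]. *)
Definition res : {scalar {mpoly K[m]}} := twist sep_residue (\det M).

(** By Cramer's rule [\det M * f i] lies in the ideal of the separated system, on which
    [sep_residue] vanishes. *)
Lemma res_ideal i q : res (f i * q) = 0.
Proof.
have : \adj M *m \col_i sep_poly i = \det M *: \col_i f i.
  rewrite -mul_scalar_mx -mul_adj_mx -mulmxA; congr (_ *m _).
  by apply/matrixP=> k l; rewrite !mxE PM; apply: eq_bigr => j _; rewrite mxE.
move/matrixP/(_ i 0); rewrite [LHS]mxE [RHS]mxE [X in _ * X]mxE => E.
rewrite /res /= /twist mulrA -E mulr_suml linear_sum big1 //= => j _.
by rewrite [(\col_i _ _) _ _]mxE -mulrA mulrCA sep_residue_poly.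
Qed.

Definition xy_set (s : {mpoly K[m + m]}) : Prop :=
  famset predT (fun i => evalX 0 (f i)) s \/
  famset predT (fun i => evalX m (sep_poly i)) s.

Lemma slice_xy Q : ideal_of xy_set Q ->
  ideal_of (famset predT f) (slice (fun b => sep_residue 'X_[b]) Q).
Proof.
elim=> [|a s R ss _ IH]; first by rewrite linear0; constructor.
rewrite linearD /= mulrC; apply: ideal_ofD IH; case: ss => -[i _ ->].
  rewrite slice_xM mulrC; apply/ideal_ofM/ideal_of_mem; by exists i.
rewrite (slice_ideal_y (f := sep_poly)); first by constructor.
  by move=> j q; apply: sep_residue_poly.
by rewrite mulrC; apply/ideal_ofM/ideal_of_mem; exists i.
Qed.

Lemma xy_set_sep i : ideal_of xy_set (evalX 0 (sep_poly i) - evalX m (sep_poly i)).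
Proof.
apply: ideal_ofB; last by apply: ideal_of_mem; right; exists i.
rewrite PM rmorph_sum; apply: ideal_of_sum => j _ /=; rewrite rmorphM.
by apply/ideal_ofM/ideal_of_mem; left; exists j.
Qed.

(** By the discrete Leibniz rule for [sep_poly i = \sum_j M i j * f j], the matrices [A] and [B]
    agree on [z], so their determinants agree modulo the entries [P(x) - P(y)] of [A *m z]. The
    correction separating [B] from [N] has entries in [I(x)]. *)
Lemma bezoutian_sep :
  ideal_of xy_set (\prod_i sep_dd i - evalX m (\det M) * bezoutian 1 f).
Proof.
pose z : 'cV[{mpoly K[m + m]}]_m := \col_j zvar j.
pose A := diag_mx (\row_i sep_dd i).
pose N := map_mx (evalX m) M *m theta_mx f.
pose B := N + \matrix_(i, j) \sum_k theta (M i k) j * evalX 0 (f k).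
have Az i : (A *m z) i 0 = evalX 0 (sep_poly i) - evalX m (sep_poly i).
  by rewrite mul_diag_mx !mxE sep_ddE.
have AB : A *m z = B *m z.
  apply/matrixP=> i j; rewrite (ord1 j) {j} Az mulmxDl -mulmxA mxE.
  have tz k : (theta_mx f *m z) k 0 = evalX 0 (f k) - evalX m (f k).
    by rewrite mxE -theta_sum; apply: eq_bigr => j _; rewrite !mxE.
  rewrite [X in _ = X + _]mxE; under [X in _ = X + _]eq_bigr do rewrite tz mxE.
  have -> : (\matrix_(i, j) (\sum_k theta (M i k) j * evalX 0 (f k)) *m z) i 0
     = \sum_k (evalX 0 (M i k) - evalX m (M i k)) * evalX 0 (f k).
    rewrite mxE; under eq_bigr do rewrite !mxE mulr_suml.
    rewrite exchange_big /=; apply: eq_bigr => k _; rewrite -theta_sum mulr_suml.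
    by apply: eq_bigr => j _; rewrite mulrAC.
  rewrite PM !rmorph_sum -sumrB -big_split /=; apply: eq_bigr => k _.
  by rewrite !rmorphM; ring.
have -> : \prod_i sep_dd i = \det A.
  by rewrite det_diag; apply: eq_bigr => i _; rewrite mxE.
have -> : evalX m (\det M) * bezoutian 1 f = \det N.
  by rewrite det_mulmx bezoutian1 det_map_mx.
have -> : \det A - \det N = (\det A - \det B) + (\det B - \det N) by ring.
apply: ideal_ofD.
  apply: (sub_ideal_of (S := famset predT (fun i => (A *m z) i 0))).
    by move=> s [i _ ->]; rewrite Az; apply: xy_set_sep.
  apply: det_eq_mod_syzygy => // [j|k p]; first by rewrite mxE zvar_neq0.
  rewrite mxE => H.
  have /zvar_regular : ideal_of (famset (fun j : 'I_m => (j < k)%N)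
      (fun j => zvar j)) (p * zvar k).
    by apply: sub_ideal_of H => s [j jk ->]; rewrite mxE; apply: ideal_of_mem; exists j.
  by apply: sub_ideal_of => s [j jk ->]; apply: ideal_of_mem; exists j; rewrite ?mxE.
apply: ideal_of_detB => i j; rewrite [B i j]mxE addrAC subrr add0r mxE.
apply: ideal_of_sum => k _; apply/ideal_ofM/ideal_of_mem; left; by exists k.
Qed.

(** Modulo [xy_set], [E] may be replaced by [D], and then [p(y)] by [p(x)], which leaves the slice
    as a factor; the slice of [D] is 1. *)
Lemma res_reproducing p :
  ideal_of (famset predT f)
    (slice (fun b => res (p * 'X_[b])) (bezoutian 1 f) - p).
Proof.
pose T := slice (fun b => sep_residue 'X_[b]).
have -> : slice (fun b => res (p * 'X_[b])) (bezoutian 1 f) =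
    T (evalX m p * (evalX m (\det M) * bezoutian 1 f)).
  rewrite /T mulrA -rmorphM slice_yM; apply: eq_slice => b.
  by rewrite /res /= /twist; congr sep_residue; ring.
set D := \prod_i sep_dd i; set E := evalX m (\det M) * _.
have pE : T (evalX 0 p * D) = p by rewrite /T slice_xM slice_sep_dd mulr1.
rewrite -[X in _ - X]pE /T -linearB /=; apply: slice_xy.
rewrite (_ : _ - _ = (- evalX m p) * (D - E) - (evalX 0 p - evalX m p) * D);
  last by ring.
apply: ideal_ofB; first exact/ideal_ofM/bezoutian_sep.
(* The difference [p(x) - p(y)] is a combination of the [zvar j], and each [zvar j] times the factor
   [sep_dd j] of [D] is [P_j(x) - P_j(y)]. *)
rewrite -theta_sum mulr_suml; apply: ideal_of_sum => j _.
rewrite /D (bigD1 j) //= -mulrA; apply: ideal_ofM; rewrite mulrA mulrC.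
by apply: ideal_ofM; rewrite mulrC sep_ddE; apply: xy_set_sep.
Qed.

End SeparatedResidue.

(** * Traces on the quotient algebra *)

Section QuotientBasis.
Variables (K : fieldType) (m : nat) (f : 'I_m -> {mpoly K[m]}).
Local Notation I := (ideal_of (famset predT f)).
Implicit Types (p q : {mpoly K[m]}).

Lemma ideal_ofZ (c : K) p : I p -> I (c *: p).
Proof. by rewrite -mul_mpolyC; apply: ideal_ofM. Qed.

Definition spanning n (e : 'I_n -> {mpoly K[m]}) : Prop :=
  forall p, exists c : 'rV[K]_n, I (p - \sum_i c 0 i *: e i).

Definition independent n (e : 'I_n -> {mpoly K[m]}) : Prop :=
  forall c : 'rV[K]_n, I (\sum_i c 0 i *: e i) -> c = 0.

Lemma spanning_basis n (e : 'I_n -> {mpoly K[m]}) : spanning e ->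
  exists n' (e' : 'I_n' -> {mpoly K[m]}), spanning e' /\ independent e'.
Proof.
elim: n e => [|n IH] e spe.
  by exists 0%N, e; split=> // c _; apply/matrixP=> i [].
case: (classic (independent e)) => [ind|]; first by exists n.+1, e.
case/not_all_ex_not=> c nc; have [Ic /eqP/rV0Pn[i0 ci0]] := imply_to_and _ _ nc.
apply: (IH (e \o lift i0)) => p; have [a Ia] := spe p.
(* This multiple of the nontrivial relation [c] eliminates [e i0] from the expansion of [p]. *)
pose t := a 0 i0 / c 0 i0.
exists (\row_j (a 0 (lift i0 j) - t * c 0 (lift i0 j))).
have -> : \sum_j (\row_j (a 0 (lift i0 j) - t * c 0 (lift i0 j))) 0 j
      *: (e \o lift i0) j = \sum_i a 0 i *: e i - t *: \sum_i c 0 i *: e i.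
  rewrite scaler_sumr -sumrB (bigD1_ord i0) //= scalerA -scalerBl /t divfK //.
  rewrite subrr scale0r add0r; apply: eq_bigr => j _.
  by rewrite mxE scalerA -scalerBl.
by rewrite opprB addrCA addrC; apply: ideal_ofD => //; apply: ideal_ofZ.
Qed.

Lemma quotient_basis : quotient_findim f ->
  exists n (e : 'I_n -> {mpoly K[m]}), spanning e /\ independent e.
Proof.
case=> s sps; apply: (@spanning_basis (size s) (fun i => s`_i)) => p.
have [c /in_idealP Ic] := sps p; exists (\row_i c i).
by under eq_bigr do rewrite mxE.
Qed.

Variables (n : nat) (e : 'I_n -> {mpoly K[m]}).
Hypotheses (span_e : spanning e) (free_e : independent e).

Definition coord p : 'rV[K]_n :=
  epsilon (inhabits 0) (fun c : 'rV[K]_n => I (p - \sum_i c 0 i *: e i)).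

Lemma coordP p : I (p - \sum_i coord p 0 i *: e i).
Proof.
exact: (epsilon_spec (inhabits 0)
  (fun c : 'rV[K]_n => I (p - \sum_i c 0 i *: e i)) (span_e p)).
Qed.

Lemma coord_unique p (c : 'rV[K]_n) :
  I (p - \sum_i c 0 i *: e i) -> coord p = c.
Proof.
move=> Ic; apply/eqP; rewrite -subr_eq0; apply/eqP/free_e.
have := ideal_ofB Ic (coordP p); rewrite opprB addrC addrA subrK -sumrB.
by congr I; apply: eq_bigr => i _; rewrite !mxE scalerBl.
Qed.

Lemma coord_is_linear : linear coord.
Proof.
move=> c p q; apply: coord_unique.
rewrite (_ : _ - _ = c *: (p - \sum_i coord p 0 i *: e i)
                     + (q - \sum_i coord q 0 i *: e i)).
  by apply: ideal_ofD; [apply: ideal_ofZ|]; apply: coordP.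
under eq_bigr do rewrite !mxE scalerDl -scalerA.
by rewrite big_split /= -scaler_sumr scalerBr opprD addrACA.
Qed.
HB.instance Definition _ := GRing.isLinear.Build K {mpoly K[m]} 'rV[K]_n _ coord
  coord_is_linear.

Lemma coord_ideal p : I p -> coord p = 0.
Proof.
move=> Ip; apply: coord_unique; rewrite big1 ?subr0 // => i _.
by rewrite mxE scale0r.
Qed.

Lemma ideal_coord p : coord p = 0 -> I p.
Proof.
move=> p0; have := coordP p; rewrite p0 big1 ?subr0 // => i _.
by rewrite mxE scale0r.
Qed.

Lemma eq_coord p q : I (p - q) -> coord p = coord q.
Proof. by move/coord_ideal/eqP; rewrite linearB subr_eq0 => /eqP. Qed.

Definition mulmat q : 'M[K]_n := \matrix_k coord (q * e k).

Lemma coordM q p : coord (q * p) = coord p *m mulmat q.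
Proof.
rewrite (@eq_coord _ (q * \sum_i coord p 0 i *: e i)); last first.
  by rewrite -mulrBr; apply/ideal_ofM/coordP.
rewrite mulr_sumr linear_sum mulmx_sum_row /=; apply: eq_bigr => i _.
by rewrite -scalerAr linearZ rowK.
Qed.

Lemma mulmatX q k : mulmat (q ^+ k) = mulmat q ^+ k.
Proof.
elim: k => [|k IH]; apply/row_matrixP => i; rewrite rowK.
  rewrite expr0 mul1r row1; apply: coord_unique; rewrite (bigD1 i) //=.
  rewrite mxE !eqxx scale1r big1 ?addr0 ?subrr; first by constructor.
  by move=> j /negPf ji; rewrite mxE ji andbF scale0r.
rewrite exprS -mulrA coordM exprSr row_mul; congr (_ *m _).
by rewrite -IH rowK.
Qed.

Lemma mulmat_eq0 q : mulmat q = 0 <-> I q.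
Proof.
split=> [q0|Iq].
  by apply: ideal_coord; rewrite -[q]mulr1 coordM q0 mulmx0.
by apply/row_matrixP=> i; rewrite rowK row0 coord_ideal // mulrC; apply: ideal_ofM.
Qed.

Lemma functional_ideal (L : {scalar {mpoly K[m]}}) :
  (forall i q, L (f i * q) = 0) -> forall p, I p -> L p = 0.
Proof.
move=> Lf p; elim=> [|a s r [i _ ->] _ IH]; first exact: linear0.
by rewrite linearD /= IH addr0 mulrC Lf.
Qed.

(* The reproducing property writes multiplication by [q] modulo [I] as a sum of
   rank one operators whose traces add up to [L (J * q)]. *)
Lemma mxtrace_mulmat (L : {scalar {mpoly K[m]}}) :
  (forall i q, L (f i * q) = 0) ->
  (forall p, I (slice (fun b => L (p * 'X_[b])) (bezoutian 1 f) - p)) ->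
  forall q, \tr (mulmat q) = L (jacobian f * q).
Proof.
move=> Lf Lrep q; set B := bezoutian 1 f.
pose u c := B@_c *: 'X_[mfst c] : {mpoly K[m]}.
have JE : jacobian f = \sum_(c <- msupp B) u c * 'X_[msnd c].
  rewrite -diag_bezoutian1 -/B [in LHS](mpoly_xyE B) rmorph_sum.
  by apply: eq_bigr => c _; rewrite rmorphM /= !diag_evalX.
have cE k : coord (q * e k) =
    \sum_(c <- msupp B) L (e k * 'X_[msnd c]) *: coord (q * u c).
  rewrite (@eq_coord _ (q * slice (fun b => L (e k * 'X_[b])) B)); last first.
    by rewrite -mulrBr -opprB mulrN; apply/ideal_ofN/ideal_ofM.
  rewrite /slice /mext mulr_sumr linear_sum; apply: eq_bigr => c _ /=.
  by rewrite /u -!scalerAr !linearZ /= !scalerA; congr (_ *: _); apply: mulrC.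
rewrite /mxtrace JE mulr_suml linear_sum /=.
under eq_bigr do rewrite mxE cE summxE.
rewrite exchange_big /=; apply: eq_bigr => c _.
have -> : L (u c * 'X_[msnd c] * q)
    = L ((\sum_k coord (q * u c) 0 k *: e k) * 'X_[msnd c]).
  apply/eqP; rewrite -subr_eq0 -linearB /=; apply/eqP/(functional_ideal Lf).
  rewrite (_ : _ - _ = 'X_[msnd c] *
    (q * u c - \sum_k coord (q * u c) 0 k *: e k)); last by ring.
  exact/ideal_ofM/coordP.
rewrite mulr_suml linear_sum /=; apply: eq_bigr => k _.
by rewrite -scalerAl linearZ mxE mulrC.
Qed.

End QuotientBasis.

(** * Existence of the residue and the description of the radical *)

Section Residue.
Variables (K : fieldType) (m : nat) (f : 'I_m -> {mpoly K[m]}).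
Local Notation I := (ideal_of (famset predT f)).

(** Cayley-Hamilton puts the characteristic polynomial of multiplication by each variable, evaluated
    at that variable, in [I]. All have degree [n + 1], so they form a separated system of the
    required shape. *)
Lemma residue_exists n (e : 'I_n.+1 -> {mpoly K[m]}) :
  spanning f e -> independent f e ->
  exists L : {scalar {mpoly K[m]}}, (forall i q, L (f i * q) = 0) /\
  forall p, I (slice (fun b => L (p * 'X_[b])) (bezoutian 1 f) - p).
Proof.
move=> spe fre; pose P i := char_poly (mulmat f e 'X_i).
have monP i : P i \is monic by apply: char_poly_monic.
have sizeP i : size (P i) = n.+2 by rewrite size_char_poly.
have PI i : in_ideal f (sep_poly n P i).
  apply/in_idealP/(ideal_coord spe).
  have -> : coord f e (sep_poly n P i)
      = coord f e 1 *m horner_mx (mulmat f e 'X_i) (P i).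
    rewrite -[in RHS](coefK (P i)) sizeP poly_def !linear_sum.
    apply: eq_bigr => k _; rewrite !linearZ /= rmorphXn /= horner_mx_X.
    by rewrite -mulmatX // -coordM // mulr1.
  by rewrite Cayley_Hamilton mulmx0.
have [g gE] := fin_all_exists PI; pose M := \matrix_(i, j) g i j.
have PM i : sep_poly n P i = \sum_j M i j * f j.
  by rewrite gE; apply: eq_bigr => j _; rewrite mxE.
exists (res n P M); split; first exact: res_ideal.
exact: res_reproducing.
Qed.

End Residue.

Theorem theorem4p3 (K : closedFieldType) (m : nat)
  (f : 'I_m -> {mpoly K[m]})
  (E E' : seq 'X_{1..m}) :
  [pchar K] =i pred0 ->
  quotient_findim f ->
  uniq E -> uniq E' ->
  (forall a b, bcoef 1 f a b != 0 -> a \in E /\ b \in E') ->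
  (forall a b, bcoef (jacobian f) f a b != 0 -> a \in E /\ b \in E') ->
  forall p : {mpoly K[m]},
    in_radical f p <->
    exists lam : 'X_{1..m} -> K,
      bez_apply (jacobian f) f E E' lam = 0 /\
      exists q : {mpoly K[m]}, in_ideal f q /\ p = bez_apply 1 f E E' lam + q.
Proof.
move=> char0 fin uE uE' sub1 subJ p.
have [n [e [spe fre]]] := quotient_basis fin.
(* A zero quotient means that [I] is the whole ring; it is split off because the residue needs
   positive dimension. *)
case: n e spe fre => [|n] e spe fre.
  have all_in q : in_ideal f q.
    by apply/in_idealP; have [c] := spe q; rewrite big_ord0 subr0.
  split=> [_|_]; last by exists 0%N; apply: all_in.
  exists (fun=> 0); split.
    by rewrite /bez_apply big1 // => a _; rewrite big1 // => b _; rewrite mulr0 scale0r.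
  exists (p - bez_apply 1 f E E' (fun=> 0)); split; first exact: all_in.
  by rewrite addrC subrK.
have [L [Lf Lrep]] := residue_exists spe fre.
have trE q := mxtrace_mulmat spe fre Lf Lrep q.
split=> [[k pk]|[lam [BJ0 [q [/in_idealP Iq pE]]]]].
  exists (fun b => L (p * 'X_[b])); rewrite !bez_applyE //; split; last first.
    exists (p - slice (fun b => L (p * 'X_[b])) (bezoutian 1 f)).
    split; last by rewrite addrC subrK.
    by apply/in_idealP; rewrite -opprB; apply: ideal_ofN.
  pose L' : {scalar {mpoly K[m]}} := twist L p.
  have L'f i r : L' (f i * r) = 0 by rewrite /L' /= /twist mulrCA Lf.
  (* The functional [L'] kills [I], so in the [y]-variables the Bezoutian of [J] acts as [J(y)]
     times that of 1. *)
  rewrite -[X in slice _ X](subrK (evalX m (jacobian f) * bezoutian 1 f)).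
  rewrite -[fun b => _]/(fun b => L' 'X_[b]) linearD /=.
  rewrite (slice_ideal_y L'f (bezoutian_y _ _)) add0r slice_yM.
  rewrite (eq_slice (lam' := fun=> 0)) => [|b].
    by rewrite /slice /mext big1 // => c _; rewrite scale0r scaler0.
  (* The remaining value [L (p * (J * 'X_[b]))] is the trace of multiplication by [p * 'X_[b]],
     which is nilpotent since [p ^+ k] lies in [I]. *)
  rewrite /L' /= /twist mulrCA -trE; apply: (@mxtrace_nilpotent _ _ _ k).
  rewrite -mulmatX //; apply/mulmat_eq0 => //.
  by rewrite exprMn mulrC; apply/ideal_ofM/in_idealP.
rewrite !bez_applyE // in BJ0 pE.
(* In the [x]-variables the slice of the Bezoutian of [J] is [J] times that of 1 modulo [I], and it
   is zero by the choice of [lam]. *)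
have IJp : ideal_of (famset predT f) (jacobian f * p).
  rewrite pE mulrDr; apply: ideal_ofD; last exact: ideal_ofM.
  have := slice_ideal_x lam (bezoutian_x (jacobian f) f).
  by rewrite linearB /= BJ0 slice_xM sub0r => /ideal_ofN; rewrite opprK.
(* The trace of the [k.+1]-st power is [L (J * p ^+ k.+1)], which vanishes because [J * p] lies in
   [I]. *)
have [|k pk] := @nilpotent_of_mxtrace _ _ (mulmat f e p) char0.
  move=> k; rewrite -mulmatX // trE (functional_ideal Lf) //.
  by rewrite exprS mulrA mulrC; apply: ideal_ofM.
exists k; apply/in_idealP; apply: (mulmat_eq0 spe fre _).1.
by rewrite mulmatX.
Qed.
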